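(* Let $A$ be a quasi-quantale, let $B$ be a subquasi-quantale of $A$ satisfying $(\star)$, and let $S$ be a subspace of $Spec_B(A)$. Let $\tau=m_*\circ m\colon B\to B$ be the multiplicative nucleus associated with $S$. Then the following conditions are equivalent: (a) $S$ is a normal topological space. (b) $B_\tau$ is a normal lattice.
   Context: A quasi-quantale is a complete lattice $A$ with an associative product $A\times A\to A$ such that for all directed subsets $X,Y\subseteq A$ and all $a\in A$: $(\bigvee X)a=\bigvee\{xa\mid x\in X\}$ and $a(\bigvee Y)=\bigvee\{ay\mid y\in Y\}$. A subquasi-quantale $B$ of $A$ is a sub-$\bigvee$-semilattice (a subset closed under arbitrary joins of $A$) which is a quasi-quantale with the restriction of the product of $A$. $B$ satisfies $(\star)$ if $0,1\in B$ and $1b\leq b$, $b1\leq b$ for all $b\in B$. An element $1\neq p\in A$ is prime relative to $B$ if $ab\leq p$ with $a,b\in B$ implies $a\leq p$ or $b\leq p$; $Spec_B(A)$ is the set of elements of $A$ that are prime relative to $B$, with the topology whose open sets are $\mathcal{U}(b)=\{p\in Spec_B(A)\mid b\nleq p\}$, $b\in B$. For a subspace $S\subseteq Spec_B(A)$, with frame of open sets $\mathcal{O}(S)$, let $m\colon B\to\mathcal{O}(S)$, $m(b)=\mathcal{U}(b)\cap S$, and let $m_*\colon\mathcal{O}(S)\to B$, $m_*(W)=\bigvee\{b\in B\mid m(b)\subseteq W\}$, be its right adjoint. Then $\tau=m_*\circ m$ is a closure operator on $B$ with $\tau(xy)=\tau(x)\wedge\tau(y)$, where $\wedge$ is the meet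 in the complete lattice $B$ (a multiplicative nucleus). $B_\tau=\{b\in B\mid\tau(b)=b\}$ is a complete lattice with join $\tau(\bigvee X)$, top $1$ and bottom $\tau(0)$, and with induced product $(a,b)\mapsto\tau(ab)=a\wedge b$. $B_\tau$ is normal if for all $a,b\in B_\tau$ with $\tau(a\vee b)=1$ there exist $a',b'\in B_\tau$ with $\tau(a\vee b')=1=\tau(a'\vee b)$ and $\tau(a'b')=\tau(0)$. A topological space is normal if any two disjoint closed subsets are contained respectively in two disjoint open subsets (no separation axiom such as $T_1$ is assumed). *)

(* Defs.v *)
From HB Require Import structures.
From mathcomp Require Import all_boot all_order.
From mathcomp Require Import boolp classical_sets functions.
From mathcomp Require Import topology_structure initial_topology.
From mathcomp Require Import subtype_topology separation_axioms.

Set Implicit Arguments.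
Unset Strict Implicit.
Unset Printing Implicit Defensive.

Import Order.TTheory.
Local Open Scope order_scope.
Local Open Scope classical_set_scope.

HB.mixin Record TBLattice_hasSup d T of Order.TBLattice d T := {
  bigsup : set T -> T;
  bigsupP : forall X : set T, supremums X (bigsup X)
}.

#[short(type="completeLatticeType")]
HB.structure Definition CompleteLattice d :=
  {T of Order.TBLattice d T & TBLattice_hasSup d T}.

(* A partial order in which every subset has a supremum is a complete lattice:
   meets are the joins of the sets of lower bounds. *)
HB.factory Record POrder_hasSup d T of Order.POrder d T := {
  sup : set T -> T;
  supP : forall X : set T, supremums X (sup X)
}.

HB.builders Context d T of POrder_hasSup d T.

Let sup_ub (X : set T) x : X x -> x <= sup X.
Proof. by move=> Xx; have [/(_ x Xx)] := supP X. Qed.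

Let sup_le (X : set T) y : (forall x, X x -> x <= y) -> sup X <= y.
Proof. by move=> Xy; have [_ /(_ y Xy)] := supP X. Qed.

Let meet x y := sup [set z | z <= x /\ z <= y].
Let join x y := sup [set x; y].

Let meetP x y z : (x <= meet y z) = (x <= y) && (x <= z).
Proof.
apply/idP/andP => [xm|[xy xz]]; last exact: sup_ub.
by split; apply: (le_trans xm); apply: sup_le => w [].
Qed.

Let joinP x y z : (join x y <= z) = (x <= z) && (y <= z).
Proof.
apply/idP/andP => [jz|[xz yz]]; last by apply: sup_le => w [->|->].
by split; apply: le_trans jz; apply: sup_ub; [left|right].
Qed.

HB.instance Definition _ :=
  Order.POrder_MeetJoin_isLattice.Build d T meetP joinP.

Let sup0x x : sup set0 <= x. Proof. by apply: sup_le. Qed.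
Let supx1 x : x <= sup setT. Proof. exact: sup_ub. Qed.

HB.instance Definition _ := Order.hasBottom.Build d T sup0x.
HB.instance Definition _ := Order.hasTop.Build d T supx1.
HB.instance Definition _ := TBLattice_hasSup.Build d T supP.
HB.end.

Section CompleteLatticeTheory.
Context d (T : completeLatticeType d).
Implicit Types (X Y : set T) (x y : T).

Lemma bigsup_ub X x : X x -> x <= bigsup X.
Proof. by move=> Xx; have [/(_ x Xx)] := bigsupP X. Qed.

Lemma bigsup_le X y : (forall x, X x -> x <= y) -> bigsup X <= y.
Proof. by move=> Xy; have [_ /(_ y Xy)] := bigsupP X. Qed.

Lemma bigsup_leP X y : bigsup X <= y <-> (forall x, X x -> x <= y).
Proof.
by split=> [Xy x Xx|]; [exact: le_trans (bigsup_ub Xx) Xy|exact: bigsup_le].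
Qed.

End CompleteLatticeTheory.

Definition directed d (T : porderType d) (X : set T) :=
  X !=set0 /\
  forall x y, X x -> X y -> exists z, [/\ X z, x <= z & y <= z].

HB.mixin Record CompleteLattice_isQuasiQuantale d T of CompleteLattice d T := {
  qmul : T -> T -> T;
  qmulA : associative qmul;
  qmul_supl : forall (X : set T) (a : T), directed X ->
    qmul (bigsup X) a = bigsup [set qmul x a | x in X];
  qmul_supr : forall (a : T) (Y : set T), directed Y ->
    qmul a (bigsup Y) = bigsup [set qmul a y | y in Y]
}.

#[short(type="quasiQuantaleType")]
HB.structure Definition QuasiQuantale d :=
  {T of CompleteLattice d T & CompleteLattice_isQuasiQuantale d T}.

Section QuasiQuantaleTheory.
Context d (A : quasiQuantaleType d).
Implicit Types (a b c : A).

Let directed2 a b : a <= b -> directed [set a; b].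
Proof.
move=> ab; split; first by exists a; left.
by move=> x y xab yab; exists b; split; [right|case: xab => ->|case: yab => ->].
Qed.

Let bigsup2 a b : a <= b -> bigsup [set a; b] = b.
Proof.
move=> ab; apply/le_anti/andP; split; last by apply: bigsup_ub; right.
by apply: bigsup_le => x [->|->].
Qed.

Lemma qmul_lel c a b : a <= b -> qmul a c <= qmul b c.
Proof.
move=> ab; rewrite -[in leRHS](bigsup2 ab) qmul_supl; last exact: directed2.
by apply: bigsup_ub; exists a => //; left.
Qed.

Lemma qmul_ler c a b : a <= b -> qmul c a <= qmul c b.
Proof.
move=> ab; rewrite -[in leRHS](bigsup2 ab) qmul_supr; last exact: directed2.
by apply: bigsup_ub; exists a => //; left.
Qed.

End QuasiQuantaleTheory.

Record subQuasiQuantale d (A : quasiQuantaleType d) := SubQuasiQuantale {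
  sqq_set : set A;
  sqq_sup : forall X : set A, X `<=` sqq_set -> sqq_set (bigsup X);
  sqq_mul : forall a b : A, sqq_set a -> sqq_set b -> sqq_set (qmul a b)
}.

(* Joins and products of B are those of A, so the associativity and directed
   distributivity laws are inherited: B is itself a quasi-quantale (instance
   below). Its binary meets need not be those of A. *)
Definition sqq_sort d (A : quasiQuantaleType d) (B : subQuasiQuantale A) :
  Type := set_type (sqq_set B).
Coercion sqq_sort : subQuasiQuantale >-> Sortclass.

Section SubQuasiQuantaleInstance.
Context d (A : quasiQuantaleType d) (B : subQuasiQuantale A).

HB.instance Definition _ := SubChoice.copy (sqq_sort B) (set_type (sqq_set B)).
HB.instance Definition _ :=
  [SubChoice_isSubPOrder of (sqq_sort B) by <: with d].

Lemma sqq_valP (b : B) : sqq_set B (val b).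
Proof. by apply: set_mem; exact: valP b. Qed.

Definition sqq_Sub (x : A) (Bx : sqq_set B x) : B := Sub x (mem_set Bx).

Lemma sqq_val_in (X : set B) : val @` X `<=` sqq_set B.
Proof. by move=> _ [b _ <-]; exact: sqq_valP. Qed.

Definition sqq_bigsup (X : set B) : B :=
  sqq_Sub (sqq_sup (@sqq_val_in X)).

Lemma sqq_bigsupP (X : set B) : supremums X (sqq_bigsup X).
Proof.
split=> [b Xb|c Xc]; rewrite -Order.le_val SubK.
- by apply: bigsup_ub; exists b.
- by apply: bigsup_le => _ [b Xb <-]; rewrite Order.le_val; exact: Xc.
Qed.

HB.instance Definition _ := POrder_hasSup.Build d (sqq_sort B) sqq_bigsupP.

Lemma val_bigsup (X : set B) : val (bigsup X) = bigsup (val @` X).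
Proof. exact: SubK. Qed.

Definition sqq_qmul (a b : B) : B :=
  sqq_Sub (sqq_mul (sqq_valP a) (sqq_valP b)).

Let sqq_qmulA : associative sqq_qmul.
Proof. by move=> a b c; apply: val_inj; rewrite !SubK qmulA. Qed.

Let directed_val (X : set B) : directed X -> directed (val @` X).
Proof.
move=> [[b Xb] dirX]; split; first by exists (val b); exists b.
move=> _ _ [x Xx <-] [y Xy <-]; have [z [Xz xz yz]] := dirX x y Xx Xy.
by exists (val z); split; [exists z|rewrite Order.le_val|rewrite Order.le_val].
Qed.

Let sqq_qmul_supl (X : set B) (a : B) : directed X ->
  sqq_qmul (bigsup X) a = bigsup [set sqq_qmul x a | x in X].
Proof.
move=> dX; apply: val_inj; rewrite SubK !val_bigsup qmul_supl.
  by rewrite !image_comp; congr bigsup; apply: eq_imagel => x _; rewrite /= SubK.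
exact: directed_val.
Qed.

Let sqq_qmul_supr (a : B) (X : set B) : directed X ->
  sqq_qmul a (bigsup X) = bigsup [set sqq_qmul a x | x in X].
Proof.
move=> dX; apply: val_inj; rewrite SubK !val_bigsup qmul_supr.
  by rewrite !image_comp; congr bigsup; apply: eq_imagel => x _; rewrite /= SubK.
exact: directed_val.
Qed.

HB.instance Definition _ := CompleteLattice_isQuasiQuantale.Build d (sqq_sort B)
  sqq_qmulA sqq_qmul_supl sqq_qmul_supr.

Lemma val_qmul (a b : B) : val (qmul a b) = qmul (val a) (val b).
Proof. exact: SubK. Qed.

End SubQuasiQuantaleInstance.

Definition sqq_star d (A : quasiQuantaleType d) (B : subQuasiQuantale A) :=
  [/\ sqq_set B \bot, sqq_set B \top &
      forall b : A, sqq_set B b -> qmul \top b <= b /\ qmul b \top <= b].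

Lemma val_top d (A : quasiQuantaleType d) (B : subQuasiQuantale A) :
  sqq_star B -> val (\top : B) = \top.
Proof.
case=> _ B1 _; apply/le_anti; rewrite lex1 /=.
exact: (lex1 (sqq_Sub B1)).
Qed.

Lemma val_bot d (A : quasiQuantaleType d) (B : subQuasiQuantale A) :
  sqq_star B -> val (\bot : B) = \bot.
Proof.
case=> B0 _ _; apply/le_anti; rewrite le0x andbT.
exact: (le0x (sqq_Sub B0)).
Qed.

Definition relative_prime d (A : quasiQuantaleType d) (B : subQuasiQuantale A)
    (p : A) :=
  p <> \top /\
  forall a b : A, sqq_set B a -> sqq_set B b ->
    qmul a b <= p -> a <= p \/ b <= p.

(* The underlying set depends only on B; the hypothesis on B is what makes the
   sets specU b a topology. *)
Definition spec d (A : quasiQuantaleType d) (B : subQuasiQuantale A)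
    (starB : sqq_star B) : Type :=
  set_type [set p : A | relative_prime B p].

Section Spec.
Context d (A : quasiQuantaleType d) (B : subQuasiQuantale A).
Variable starB : sqq_star B.

HB.instance Definition _ := SubChoice.copy (spec starB)
  (set_type [set p : A | relative_prime B p]).

Definition specU (b : B) : set (spec starB) :=
  [set p | ~ (val b <= val p)].

Lemma specP (p : spec starB) : relative_prime B (val p).
Proof. by have /set_mem := valP p. Qed.

Lemma specUT : specU \top = setT.
Proof.
apply/seteqP; split=> // p _; rewrite /specU /mkset val_top// => p1.
by have [+ _] := specP p; apply; apply/eqP; rewrite -[_ == _]le1x.
Qed.

Lemma specUI (a b : B) : specU a `&` specU b = specU (qmul a b).
Proof.
have [_ _ star1] := starB.
apply/seteqP; split=> p; rewrite /setI /specU /mkset val_qmul.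
- case=> ap bp abp; have [_ pr] := specP p.
  by case: (pr _ _ (sqq_valP a) (sqq_valP b) abp).
- move=> abp; split=> [ap|bp]; apply: abp.
  + apply: le_trans (qmul_ler _ (lex1 _)) _.
    by apply: le_trans ap; have [] := star1 _ (sqq_valP a).
  + apply: le_trans (qmul_lel _ (lex1 _)) _.
    by apply: le_trans bp; have [] := star1 _ (sqq_valP b).
Qed.

Lemma specU_bigsup (X : set B) :
  specU (bigsup X) = \bigcup_(b in X) specU b.
Proof.
apply/seteqP; split=> p; rewrite /specU /mkset val_bigsup.
- move=> /bigsup_leP/existsNP[_ /not_implyP[[b Xb <-] bp]].
  by exists b.
- case=> b Xb bp /bigsup_leP Xp; apply: bp; apply: Xp; by exists b.
Qed.

Let spec_openT : range specU setT.
Proof. by exists \top => //; exact: specUT. Qed.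

Let spec_openI : setI_closed (range specU).
Proof.
by move=> _ _ [a _ <-] [b _ <-]; exists (qmul a b) => //; rewrite specUI.
Qed.

Let spec_open_bigU (I : Type) (f : I -> set (spec starB)) :
  (forall i, range specU (f i)) -> range specU (\bigcup_i f i).
Proof.
move=> of_; exists (bigsup [set b | exists i, specU b = f i]) => //.
rewrite specU_bigsup; apply/seteqP; split=> p /=.
- by case=> b [i bi] bp; exists i => //; rewrite -bi.
- by case=> i _; have [b _ bi] := of_ i; rewrite -bi => bp; exists b => //; exists i.
Qed.

HB.instance Definition _ := @isOpenTopological.Build (spec starB)
  (range specU) spec_openT spec_openI spec_open_bigU.

Lemma spec_openE (W : set (spec starB)) : open W <-> exists b : B, specU b = W.
Proof. by split=> [[b _ <-]|[b <-]]; exists b. Qed.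

End Spec.

(* The subspace S is the type set_type S with the library's (initial) subspace
   topology; the trace on S of a set U of Spec_B(A) is its preimage by set_val. *)
Section Nucleus.
Context d (A : quasiQuantaleType d) (B : subQuasiQuantale A).
Variables (starB : sqq_star B) (S : set (spec starB)).

Definition spec_m (b : B) : set S := set_val @^-1` (specU b).

Definition spec_mstar (W : set S) : B := bigsup [set b : B | spec_m b `<=` W].

Definition spec_nucleus (b : B) : B := spec_mstar (spec_m b).

Lemma open_spec_m (b : B) : open (spec_m b).
Proof. by exists (specU b) => //; apply/spec_openE; exists b. Qed.

Lemma spec_m_adj (b : B) (W : set S) :
  (spec_m b `<=` W) <-> (b <= spec_mstar W).
Proof.
split=> [bW|bW p bp]; first exact: bigsup_ub.
have : (specU (spec_mstar W)) (set_val p).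
  by move=> Wp; apply: bp; apply: le_trans Wp; rewrite Order.le_val.
by rewrite specU_bigsup => -[c cW cp]; exact: cW.
Qed.

End Nucleus.

Arguments spec_m {d A B starB} S b.
Arguments spec_mstar {d A B starB} S W.

Definition fixed_points (T : Type) (f : T -> T) : set T := [set b | f b = b].

(* Normality of the lattice Q_t of fixed points of t, whose binary join is
   t (a `|` b), top is 1, bottom is t 0 and product is t (ab). *)
Definition normal_fixed_lattice d (Q : quasiQuantaleType d) (t : Q -> Q) :=
  forall a b : Q, fixed_points t a -> fixed_points t b ->
    t (Order.join a b) = \top ->
    exists a' b' : Q, [/\ fixed_points t a', fixed_points t b',
      t (Order.join a b') = \top, t (Order.join a' b) = \top &
      t (qmul a' b') = t \bot].

(* The library's [normal_space] is stated with neighbourhoods; it is normality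
   in the usual sense, without any separation axiom. *)
Lemma normal_space_closedP (T : topologicalType) :
  normal_space T <->
  forall F G : set T, closed F -> closed G -> F `&` G = set0 ->
    exists U V : set T,
      [/\ open U, open V, F `<=` U, G `<=` V & U `&` V = set0].
Proof.
split=> [nT F G clF clG FG0|nT F clF W /set_nbhsP[C [oC FC CW]]].
- have : set_nbhs F (~` G).
    apply/set_nbhsP; exists (~` G); split=> //; first exact: closed_openC.
    exact/disjoints_subset.
  move=> /(nT F clF)[C /set_nbhsP[U [oU FU UC]] CG].
  exists U, (~` closure C); split=> //.
  + by apply: closed_openC; exact: closed_closure.
  + by apply/subsetCr.
  + by apply/disjoints_subset; rewrite setCK;
      exact: (subset_trans UC (@subset_closure _ _)).
- have FC0 : F `&` ~` C = set0 by apply/disjoints_subset; rewrite setCK.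
  have [U [V [oU oV FU CV UV0]]] := nT F (~` C) clF (open_closedC oC) FC0.
  exists U; first by apply/set_nbhsP; exists U; split.
  apply: (subset_trans _ CW); apply: (@subset_trans _ (~` V)).
    rewrite [X in _ `<=` X](iffLR (closure_id _) (open_closedC oV)).
    by apply: closureS; apply/disjoints_subset.
  exact: subsetCl CV.
Qed.

(* Main.v *)
Require Import Defs.
From mathcomp Require Import all_boot all_order.
From mathcomp Require Import classical_sets topology_structure.
From mathcomp Require Import subtype_topology separation_axioms.

(** Complementation turns normality of a space into a condition on its frame
    of open sets: whenever two open sets [U], [V] cover the space, there are
    disjoint open sets [U'], [V'] such that [U], [V'] cover and [U'], [V] cover
    ([normal_space_open_cover]). This is literally lattice normality of the
    frame. It then remains to see that the fixed points of the nucleus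
    reproduce the frame of [S]. The adjunction between [spec_m] and
    [spec_mstar] is a Galois insertion onto the open sets, because every open
    set of [S] is the trace of a basic one ([spec_mstarK]); hence [spec_m] and
    [spec_mstar] are inverse bijections between fixed points and open sets, and
    two elements have the same image under the nucleus exactly when they have
    the same trace on [S] ([spec_nucleus_eqP]). Under [spec_m], joins become
    unions (a left adjoint preserves joins) and products become intersections
    (by primeness in one direction, and because a product in [B] lies below both
    factors in the other), so the two forms of normality are
    translations of each other. *)

Import Order.TTheory.
Local Open Scope order_scope.
Local Open Scope classical_set_scope.

(** The complements of two open sets are disjoint exactly when these sets
    cover, and a set contains the complement of [U] exactly when it covers the
    space together with [U]; so the open set that separates the complement of
    [U] is the partner of [U]. *)
Lemma normal_space_open_cover (T : topologicalType) :
  normal_space T <->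
  forall U V : set T, open U -> open V -> U `|` V = setT ->
    exists U' V' : set T,
      [/\ open U', open V', U `|` V' = setT, U' `|` V = setT &
        U' `&` V' = set0].
Proof.
split=> [/normal_space_closedP nT U V oU oV UVT|coverT].
- have disjUV : ~` U `&` ~` V = set0 by rewrite -setCU UVT setCT.
  have [V' [U' [oV' oU' UV' VU' V'U'0]]] :=
    nT _ _ (open_closedC oU) (open_closedC oV) disjUV.
  exists U', V'; split=> //.
  + by rewrite -subTset -(setUv U); apply: setUS.
  + by rewrite -subTset -(setvU V); apply: setSU.
  + by rewrite setIC.
- apply/normal_space_closedP => F G clF clG FG0.
  have coverFG : ~` F `|` ~` G = setT by rewrite -setCI FG0 setC0.
  have [U' [V' [oU' oV' FV' GU' U'V'0]]] :=
    coverT _ _ (closed_openC clF) (closed_openC clG) coverFG.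
  exists V', U'; split=> //; last by rewrite setIC.
  + by move=> x Fx; have [] : (~` F `|` V') x by rewrite FV'.
  + by move=> x Gx; have [] : (U' `|` ~` G) x by rewrite GU'.
Qed.

Section TraceOnSubspace.
Context (d : Order.disp_t) (A : quasiQuantaleType d) (B : subQuasiQuantale A).
Context (starB : sqq_star B) (S : set (spec starB)).
Implicit Types (a b : B) (W : set (set_type S)).

Lemma spec_m_top : spec_m S \top = setT.
Proof. by rewrite /spec_m specUT preimage_setT. Qed.

Lemma spec_m_bot : spec_m S \bot = set0.
Proof. by rewrite -subset0; apply/spec_m_adj; exact: le0x. Qed.

Lemma spec_m_join a b :
  spec_m S (Order.join a b) = spec_m S a `|` spec_m S b.
Proof.
apply/seteqP; split.
- apply/spec_m_adj; rewrite leUx; apply/andP.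
  by split; apply/spec_m_adj; [exact: subsetUl|exact: subsetUr].
- rewrite subUset; split; apply/spec_m_adj.
  + by apply: le_trans (leUl a b) _; apply/spec_m_adj.
  + by apply: le_trans (leUr b a) _; apply/spec_m_adj.
Qed.

Lemma spec_m_qmul a b : spec_m S (qmul a b) = spec_m S a `&` spec_m S b.
Proof. by rewrite /spec_m -specUI preimage_setI. Qed.

(** An open set is the trace of some [b]; such a [b] lies below
    [spec_mstar S W], so the largest element whose trace is contained in [W]
    already covers all of [W]. *)
Lemma spec_mstarK W : open W -> spec_m S (spec_mstar S W) = W.
Proof.
move=> [_ /spec_openE[b <-] <-]; apply/seteqP; split; first exact/spec_m_adj.
have b_le : b <= spec_mstar S (spec_m S b) by apply/spec_m_adj.
move=> p bp le_p; apply: bp; apply: le_trans le_p.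
by rewrite Order.le_val.
Qed.

Lemma spec_m_nucleus b : spec_m S (spec_nucleus S b) = spec_m S b.
Proof. by apply: spec_mstarK; exact: open_spec_m. Qed.

Lemma spec_nucleus_eqP a b :
  spec_nucleus S a = spec_nucleus S b <-> spec_m S a = spec_m S b.
Proof.
split=> [eq_ab|]; last by rewrite /spec_nucleus => ->.
by rewrite -(spec_m_nucleus a) eq_ab spec_m_nucleus.
Qed.

Lemma spec_nucleus_top : spec_nucleus S \top = \top.
Proof. by apply/eqP; rewrite -le1x; apply/spec_m_adj. Qed.

Lemma spec_nucleus_join_topP a b :
  spec_nucleus S (Order.join a b) = \top <->
  spec_m S a `|` spec_m S b = setT.
Proof.
by rewrite -spec_m_join -spec_m_top -spec_nucleus_eqP spec_nucleus_top.
Qed.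

Lemma spec_nucleus_qmul_botP a b :
  spec_nucleus S (qmul a b) = spec_nucleus S \bot <->
  spec_m S a `&` spec_m S b = set0.
Proof. by rewrite -spec_m_qmul -spec_m_bot; exact: spec_nucleus_eqP. Qed.

Lemma spec_mstar_fixed W :
  open W -> fixed_points (spec_nucleus S) (spec_mstar S W).
Proof.
by move=> oW; rewrite /fixed_points /mkset /spec_nucleus spec_mstarK.
Qed.

End TraceOnSubspace.

Arguments spec_mstar_fixed {d A B starB S W} oW.

Theorem proposition3p7 (d : Order.disp_t) (A : quasiQuantaleType d)
    (B : subQuasiQuantale A) (starB : sqq_star B) (S : set (spec starB)) :
  normal_space (set_type S) <-> normal_fixed_lattice (spec_nucleus S).
Proof.
rewrite normal_space_open_cover; split=> [coverS a b _ _|latS U V oU oV UVT].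
- move=> /spec_nucleus_join_topP abT.
  have [U' [V' [oU' oV' aV' U'b U'V']]] :=
    coverS _ _ (open_spec_m _ a) (open_spec_m _ b) abT.
  exists (spec_mstar S U'), (spec_mstar S V').
  split; [exact: spec_mstar_fixed|exact: spec_mstar_fixed| | |].
  + by apply/spec_nucleus_join_topP; rewrite spec_mstarK.
  + by apply/spec_nucleus_join_topP; rewrite spec_mstarK.
  + by apply/spec_nucleus_qmul_botP; rewrite !spec_mstarK.
- have [|a' [b' [_ _]]] := latS _ _ (spec_mstar_fixed oU)
    (spec_mstar_fixed oV).
    by apply/spec_nucleus_join_topP; rewrite !spec_mstarK.
  move=> /spec_nucleus_join_topP; rewrite spec_mstarK// => Ub'T.
  move=> /spec_nucleus_join_topP; rewrite spec_mstarK// => a'VT.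
  move=> /spec_nucleus_qmul_botP a'b'0.
  by exists (spec_m S a'), (spec_m S b'); split=> //; exact: open_spec_m.
Qed.
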